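(* Let $K$ be a countable group, let $H<K$ be an infinite subgroup, and let $\alpha$ be an action of $K$ by automorphisms on a countable group $A$. Put $G=A\rtimes_\alpha K$, identify $K$ with the subgroup $\{e\}\times K$ of $G$, so that $H<K<G$, and put $A^*=A\setminus\{e\}$. (a) The triple $H<K<G$ satisfies condition (ST) if and only if, for every $a\in A^*$, $|\{h\in H:\alpha_h(a)=a\}|<\infty$. (b) The triple $H<K<G$ satisfies condition (SS) if and only if, for every finite set $E\subset A^*$, there exists $h\in H$ such that $E\cap\alpha_h(E)=\emptyset$. Equivalently, for every $a\in A^*$, the $H$-orbit $H\cdot a=\{\alpha_h(a):h\in H\}$ is infinite.
   Context: For a countable group $G$ and infinite subgroups $H<K$ of $G$, consider the natural left-translation action of $H$ on $(G\setminus K)/H=\{gH:g\in G\setminus K\}$. The triple $H<K<G$ satisfies condition (SS) if all orbits of this action are infinite. It satisfies condition (ST) if all stabilizers of this action are finite. *)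

(* Defs.v *)
From HB Require Import structures.
From mathcomp Require Import all_boot.
From mathcomp Require Import boolp classical_sets functions cardinality.

Set Implicit Arguments.
Unset Strict Implicit.
Unset Printing Implicit Defensive.

Local Open Scope classical_set_scope.
Local Open Scope group_scope.

Section Cosets.
Variable G : groupType.
Implicit Types (g : G) (H K C : set G).

(* [mem H] turns the Prop-valued [H] into the boolean predicate that
   [group_closed] (contains 1, closed under division) expects. *)
Definition is_subgroup H : Prop := group_closed (mem H).

Definition ltranslate g C : set G := [set g * x | x in C].

(* The set (G \ K) / H. *)
Definition lcosets_outside K H : set (set G) :=
  [set ltranslate g H | g in ~` K].

Definition coset_orbit H C : set (set G) := [set ltranslate h C | h in H].

Definition coset_stab H C : set G := [set h | H h /\ ltranslate h C = C].

Definition condition_SS H K : Prop :=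
  forall C, lcosets_outside K H C -> infinite_set (coset_orbit H C).

Definition condition_ST H K : Prop :=
  forall C, lcosets_outside K H C -> finite_set (coset_stab H C).

End Cosets.

(* Bijectivity of each [alpha k] is a consequence: see [aut_action_bij]. *)
Record aut_action (K A : groupType) := AutAction {
  aut_act :> K -> A -> A;
  aut_act1 : forall a, aut_act 1 a = a;
  aut_actM : forall h k a, aut_act (h * k) a = aut_act h (aut_act k a);
  aut_act_morph : forall k, {morph aut_act k : a b / a * b}
}.

Section SemidirectProduct.
Variables (K A : groupType) (alpha : aut_action K A).

Lemma aut_actK k : cancel (alpha k) (alpha k^-1).
Proof. by move=> a; rewrite -aut_actM mulVg aut_act1. Qed.

Lemma aut_action_bij k : bijective (alpha k).
Proof.
exists (alpha k^-1); first exact: aut_actK.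
by move=> a; rewrite -{1}(invgK k) aut_actK.
Qed.

Lemma aut_actg1 k : alpha k 1 = 1.
Proof.
by apply: (mulgI (alpha k 1)); rewrite -(aut_act_morph alpha) !mulg1.
Qed.

(* The parameter [alpha] is not used in the carrier: it selects the group law. *)
Definition sdprod of aut_action K A : Type := (A * K)%type.
Local Notation G := (sdprod alpha).

HB.instance Definition _ := Choice.on G.

Definition sd_one : G := (1, 1).
Definition sd_mul (x y : G) : G := (x.1 * alpha x.2 y.1, x.2 * y.2).
Definition sd_inv (x : G) : G := (alpha x.2^-1 x.1^-1, x.2^-1).

Lemma sd_mulA : associative sd_mul.
Proof.
by move=> x y z; rewrite /sd_mul /= aut_act_morph aut_actM !mulgA.
Qed.

Lemma sd_mul1 : left_id sd_one sd_mul.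
Proof. by case=> a k; rewrite /sd_mul /= aut_act1 !mul1g. Qed.

Lemma sd_mulr1 : right_id sd_one sd_mul.
Proof. by case=> a k; rewrite /sd_mul /= aut_actg1 !mulg1. Qed.

Lemma sd_mulV : left_inverse sd_one sd_inv sd_mul.
Proof.
by case=> a k; rewrite /sd_mul /= -aut_act_morph !mulVg aut_actg1.
Qed.

Lemma sd_mulrV : right_inverse sd_one sd_inv sd_mul.
Proof.
by case=> a k; rewrite /sd_mul /= -aut_actM !mulgV aut_act1 mulgV.
Qed.

HB.instance Definition _ := isGroup.Build G
  sd_mulA sd_mul1 sd_mulr1 sd_mulV sd_mulrV.

(* Identifies [K] with the subgroup {1} x K of the semidirect product. *)
Definition sd_inK (k : K) : G := (1, k).

Lemma sd_inK_div : {morph sd_inK : h k / h / k}.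
Proof.
by move=> h k; apply/pair_equal_spec; rewrite /= invg1 !aut_actg1 mulg1.
Qed.

HB.instance Definition _ := isGroupMorphism.Build K G sd_inK sd_inK_div.

Lemma sd_inK_inj : injective sd_inK.
Proof. by move=> h k []. Qed.

Lemma sd_inK_subgroup (H : set K) : is_subgroup H -> is_subgroup (sd_inK @` H).
Proof.
rewrite /is_subgroup => -[/set_mem H1 HF]; split.
  by apply/mem_set; exists 1 => //; exact: gmulf1.
move=> _ _ /set_mem[h Hh <-] /set_mem[k Hk <-]; apply/mem_set.
exists (h / k); last exact: gmulfF.
by apply/set_mem/HF; exact/mem_set.
Qed.

End SemidirectProduct.

(* Main.v *)
(** In [A ><| K] the coset [(a, k) H] is [{a} x kH], and [h] in [H] sends it to
    [{alpha h a} x hkH]. For [k = 1] its stabiliser is that of [a], and in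
    general its orbit maps onto the orbit of [a], whence (ST) and the orbit
    form of (SS).

    The equivalence of infinite orbits with the separation of finite sets is
    B. H. Neumann's lemma on coverings by cosets, here specialised to point
    stabilisers. Suppose that every [h] sends a point of [x :: s] into the
    finite set [B]. Pick [h0] with [h0 x] outside [B], and for [b] in [B] in
    the orbit of [x] pick [g_b] with [g_b x = b]. If [h x = b], then
    [h0 g_b^-1 h] sends [x] outside [B], hence sends a point of [s] into [B],
    i.e. [h] sends it into [g_b h0^-1 B]. So every [h] sends a point of [s]
    into the finite union of [B] and the [g_b h0^-1 B], and one concludes by
    induction on [s]. *)
Require Import Defs.
From mathcomp Require Import all_boot.
From mathcomp Require Import boolp classical_sets functions cardinality.

Set Implicit Arguments.
Unset Strict Implicit.
Unset Printing Implicit Defensive.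

Local Open Scope classical_set_scope.
Local Open Scope group_scope.

Lemma ltranslateM (G : groupType) (g h : G) (C : set G) :
  ltranslate g (ltranslate h C) = ltranslate (g * h) C.
Proof.
by rewrite /ltranslate image_comp; apply: eq_imagel => x _ /=; rewrite mulgA.
Qed.

Section Subgroup.
Variables (G : groupType) (H : set G).
Hypothesis H_subgroup : is_subgroup H.

Lemma is_subgroup1 : H 1.
Proof. by case: H_subgroup => /set_mem. Qed.

Lemma is_subgroupF x y : H x -> H y -> H (x / y).
Proof.
by case: H_subgroup => _ HF Hx Hy; apply/set_mem/HF; exact/mem_set.
Qed.

Lemma is_subgroupV x : H x -> H x^-1.
Proof. by move=> Hx; rewrite -[x^-1]mul1g; apply: is_subgroupF is_subgroup1 Hx. Qed.

Lemma is_subgroupM x y : H x -> H y -> H (x * y).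
Proof. by move=> Hx /is_subgroupV Hy; rewrite -[y]invgK; exact: is_subgroupF. Qed.

End Subgroup.

Section Separation.
Variables (K A : groupType) (alpha : aut_action K A) (H : set K).
Hypothesis H_subgroup : is_subgroup H.

Lemma infinite_orbits_separate (s : seq A) (B : set A) :
    (forall a, a \in s -> infinite_set [set alpha h a | h in H]) ->
    finite_set B ->
  exists2 h, H h & forall a, a \in s -> ~ B (alpha h a).
Proof.
elim: s B => [|x s IHs] B inf_orb finB.
  by exists 1 => //; exact: is_subgroup1.
have [h0 Hh0 nBh0x] : exists2 h0, H h0 & ~ B (alpha h0 x).
  apply: contrapT => noh0; apply: (inf_orb x); first exact: mem_head.
  apply: sub_finite_set finB => _ [h Hh <-].
  by apply: contrapT => nBhx; apply: noh0; exists h.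
apply: contrapT => nosep.
have meetB h : H h -> exists2 a, a \in x :: s & B (alpha h a).
  move=> Hh; apply: contrapT => nomeet; apply: nosep; exists h => // a sa Ba.
  by apply: nomeet; exists a.
have /choice[C C_P] b : exists C : set A, finite_set C /\
    forall h, H h -> alpha h x = b -> exists2 a, a \in s & C (alpha h a).
  (* When [b] is off the orbit of [x], no [h] sends [x] to [b] and the empty set serves. *)
  have [[g Hg gx]|nog] := pselect (exists2 g, H g & alpha g x = b); last first.
    by exists set0; split=> // h Hh hx; case: nog; exists h.
  exists [set alpha (g / h0) c | c in B]; split; first exact: finite_image.
  move=> h Hh hx.
  (* This element sends [x] to [h0 x], outside [B], so the point that [meetB] yields for it lies in
     [s]. *)
  have Hk : H (h0 * (g^-1 * h)).
    by do 2?[apply: is_subgroupM => //]; exact: is_subgroupV.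
  have [a] := meetB _ Hk; rewrite inE => /predU1P[->|sa] Ba.
    by case: nBh0x; move: Ba; rewrite !aut_actM hx -gx aut_actK.
  exists a => //; exists (alpha (h0 * (g^-1 * h)) a) => //.
  by rewrite -aut_actM mulgA mulgVK mulVKg.
have [||h Hh sepB'] := IHs (B `|` \bigcup_(b in B) C b).
- by move=> a sa; apply: inf_orb; rewrite inE sa orbT.
- rewrite finite_setU; split=> //; apply: bigcup_finite => // b _.
  by case: (C_P b).
have [a] := meetB h Hh; rewrite inE => /predU1P[->|sa] Ba.
  have [c sc Cc] := (C_P (alpha h x)).2 h Hh erefl.
  by apply: (sepB' c sc); right; exists (alpha h x).
by apply: (sepB' a sa); left.
Qed.

Lemma separation_infinite_orbits :
  (forall E : set A, finite_set E -> E `<=` [set a | a <> 1] ->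
     exists2 h, H h & E `&` [set alpha h a | a in E] = set0) <->
  (forall a, a <> 1 -> infinite_set [set alpha h a | h in H]).
Proof.
split=> [sep a a1 finHa|inf_orb E finE E1].
  (* A finite orbit is itself a set that no [h] separates: both it and its translate contain
     [alpha h a]. *)
  have [|h Hh /seteqP[+ _]] := sep _ finHa.
    move=> _ [h _ <-] ha1; apply: a1.
    by rewrite -[a](aut_actK alpha h) ha1 aut_actg1.
  apply; split; last exists a => //.
    by exists h.
  by exists 1; [exact: is_subgroup1|rewrite aut_act1].
have [s Es] := (finite_seqP E).1 finE.
have [a sa|h Hh sepE] := @infinite_orbits_separate s E _ finE.
  by apply/inf_orb/E1; rewrite Es.
exists h => //; apply/seteqP; split=> // b [Eb [a Ea hab]].
by apply: (sepE a); [move: Ea; rewrite Es|rewrite hab].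
Qed.

End Separation.

Section Cosets.
Variables (K A : groupType) (alpha : aut_action K A) (H : set K).
Hypothesis H_subgroup : is_subgroup H.
Local Notation G := (sdprod alpha).
Local Notation KG := [set sd_inK alpha k | k in [set: K]].
Local Notation HG := [set sd_inK alpha h | h in H].

Lemma sd_cosetE (a : A) (k : K) :
  ltranslate ((a, k) : G) HG = [set ((a, k * h) : G) | h in H].
Proof.
rewrite /ltranslate image_comp; apply: eq_imagel => h _ /=.
by apply/pair_equal_spec; rewrite /= aut_actg1 mulg1.
Qed.

Lemma sd_inK_mul (h k : K) (a : A) :
  sd_inK alpha h * ((a, k) : G) = (alpha h a, h * k).
Proof. by apply/pair_equal_spec; rewrite /= mul1g. Qed.

Lemma sd_coset_translate (h k : K) (a : A) :
  ltranslate (sd_inK alpha h) (ltranslate ((a, k) : G) HG) =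
  ltranslate ((alpha h a, h * k) : G) HG.
Proof. by rewrite ltranslateM sd_inK_mul. Qed.

(** Right multiplication by [HG] only changes the [K]-coordinate, so a coset determines [a]. *)
Lemma sd_coset_fst (a : A) (k : K) (x : G) :
  ltranslate ((a, k) : G) HG x -> x.1 = a.
Proof. by rewrite sd_cosetE => -[h _ <-]. Qed.

Lemma sd_coset_self (a : A) (k : K) : ltranslate ((a, k) : G) HG (a, k).
Proof.
by rewrite sd_cosetE; exists 1; [exact: is_subgroup1|rewrite mulg1].
Qed.

Lemma sd_coset_absorb (a : A) (h : K) :
  H h -> ltranslate ((a, h) : G) HG = ltranslate ((a, 1) : G) HG.
Proof.
move=> Hh; rewrite !sd_cosetE; apply/seteqP; split=> _ [k Hk <-].
  by exists (h * k); [exact: is_subgroupM|rewrite mul1g].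
exists (h^-1 * k); last by rewrite mulVKg mul1g.
by apply: is_subgroupM => //; exact: is_subgroupV.
Qed.

Lemma sd_lcosets_outsideP (C : set G) :
  lcosets_outside KG HG C <->
  exists2 a, a <> 1 & exists k, C = ltranslate ((a, k) : G) HG.
Proof.
split=> [[[a k] nK <-]|[a a1 [k ->]]].
  by exists a; [move=> a1; apply: nK; exists k => //; rewrite a1|exists k].
by exists (a, k) => // -[k' _ [/esym]].
Qed.

Lemma sd_condition_STP :
  condition_ST HG KG <->
  (forall a, a <> 1 -> finite_set [set h | H h /\ alpha h a = a]).
Proof.
split=> [ST a a1|fin_stab C /sd_lcosets_outsideP[a a1 [k ->]]].
  have /ST finC : lcosets_outside KG HG (ltranslate ((a, 1) : G) HG).
    by apply/sd_lcosets_outsideP; exists a => //; exists 1.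
  have /finite_preimage fin_pre :
      {in sd_inK alpha @^-1` coset_stab HG (ltranslate ((a, 1) : G) HG) &,
       injective (sd_inK alpha)}.
    by move=> h k _ _; exact: sd_inK_inj.
  apply: sub_finite_set (fin_pre finC) => h [Hh ha]; split; first by exists h.
  (* Representative [(a, 1)] makes this work: its translate [(a, h)] differs from it by an element
     of [HG]. *)
  by rewrite sd_coset_translate ha mulg1 sd_coset_absorb.
(* For arbitrary [k], comparing first coordinates shows that an [h] fixing the coset fixes [a]. *)
apply: sub_finite_set (finite_image (sd_inK alpha) (fin_stab a a1)).
move=> _ [[h Hh <-]]; rewrite sd_coset_translate => eqC.
exists h => //; split=> //.
have := sd_coset_self (alpha h a) (h * k).
by rewrite eqC => /sd_coset_fst.
Qed.

Lemma sd_condition_SSP :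
  condition_SS HG KG <->
  (forall a, a <> 1 -> infinite_set [set alpha h a | h in H]).
Proof.
split=> [SS a a1 finHa|inf_orb C /sd_lcosets_outsideP[a a1 [k ->]] finC].
  have /SS : lcosets_outside KG HG (ltranslate ((a, 1) : G) HG).
    by apply/sd_lcosets_outsideP; exists a => //; exists 1.
  (* The map from [b] to the coset of [(b, 1)] carries the orbit of [a] onto the orbit of this
     coset. *)
  apply; apply: sub_finite_set
    (finite_image (fun b => ltranslate ((b, 1) : G) HG) finHa).
  move=> _ [_ [h Hh <-] <-]; exists (alpha h a); first by exists h.
  by rewrite sd_coset_translate mulg1 sd_coset_absorb.
apply: (inf_orb a a1).
(* [xget] picks any point of a coset, with [1] as default for the empty set; its first coordinate is
   independent of the choice, so the coset orbit maps onto the orbit of [a]. *)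
apply: sub_finite_set (finite_image (fun C => (xget (1 : G) C).1) finC).
move=> _ [h Hh <-].
exists (ltranslate ((alpha h a, h * k) : G) HG).
  by exists (sd_inK alpha h); [exists h|rewrite sd_coset_translate].
by apply: (@sd_coset_fst _ (h * k)); apply: xgetI (sd_coset_self _ _).
Qed.

End Cosets.

Theorem theorem3p3 (K A : groupType) (H : set K) (alpha : aut_action K A)
    (K_countable : countable [set: K]) (A_countable : countable [set: A])
    (H_subgroup : is_subgroup H) (H_infinite : infinite_set H) :
  let KG : set (sdprod alpha) := [set sd_inK alpha k | k in [set: K]] in
  let HG : set (sdprod alpha) := [set sd_inK alpha h | h in H] in
  let Astar : set A := [set a | a <> 1] in
  (condition_ST HG KG <->
     (forall a, Astar a -> finite_set [set h | H h /\ alpha h a = a]))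
  /\
  ((condition_SS HG KG <->
     (forall E : set A, finite_set E -> E `<=` Astar ->
        exists2 h, H h & E `&` [set alpha h a | a in E] = set0))
   /\
   ((forall E : set A, finite_set E -> E `<=` Astar ->
        exists2 h, H h & E `&` [set alpha h a | a in E] = set0) <->
    (forall a, Astar a -> infinite_set [set alpha h a | h in H]))).
Proof.
move=> KG HG Astar; split; first exact: sd_condition_STP.
have sepP := separation_infinite_orbits alpha H_subgroup.
split; last exact: sepP.
by apply: (iff_trans (sd_condition_SSP alpha H_subgroup)); exact: iff_sym.
Qed.
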